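(* No generalized Cantor set in the plane $\mathbb{R}^2$ is affinely ambient homogeneous.
   Context: A subset $N\subset\mathbb{R}^2$ is called affinely ambient homogeneous if for any two points $x,y\in N$ there is an affine transformation $h\colon\mathbb{R}^2\to\mathbb{R}^2$ (an invertible affine map) such that $h(x)=y$ and $h$ takes $N$ to itself, i.e. $h(N)=N$. The standard Cantor set is $C:=\left\{\sum_{k=1}^\infty a_k3^{-k}\in[0,1] : a_k\in\{0,2\}\right\}$. A generalized Cantor set in the plane is the image of the standard Cantor set $C$ under a continuous injective map $C\to\mathbb{R}^2$. (The paper also gives the following definition as equivalent: a set of the form $\bigcap_{n=0}^\infty\bigcup_{\alpha_1\ldots\alpha_n\in\{0,1\}^n}C_{\alpha_1\ldots\alpha_n}$, where the $C_{\alpha_1\ldots\alpha_n}$ are nonempty closed subsets of the plane such that $C_{\alpha_1\ldots\alpha_n}\supset C_{\alpha_1\ldots\alpha_n0}\cup C_{\alpha_1\ldots\alpha_n1}$ always, for each $n$ the sets $C_{\alpha_1\ldots\alpha_n}$ are pairwise disjoint, and $\lim_{n\to\infty}\max_{\alpha_1\ldots\alpha_n}\operatorname{diam}C_{\alpha_1\ldots\alpha_n}=0$.) *)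

(* Defs.v *)
From mathcomp Require Import all_boot all_order all_algebra.
From mathcomp Require Import all_classical all_reals all_analysis.

Set Implicit Arguments.
Unset Strict Implicit.
Unset Printing Implicit Defensive.

Import Order.TTheory GRing.Theory Num.Theory.
Import numFieldNormedType.Exports.

Local Open Scope classical_set_scope.
Local Open Scope ring_scope.

(* The sums below always lie in [0, 1]; the value of a at 0 is irrelevant. *)
Definition standard_cantor_set (R : realType) : set R :=
  [set x : R | exists a : nat -> R, (forall k, a k = 0 \/ a k = 2) /\
    \sum_(1 <= k < n) a k * 3 ^- k @[n --> \oo] --> x].
Arguments standard_cantor_set R : clear implicits.

(* Maps defined on the standard Cantor set are represented by total functions
   on R constrained only on that set: continuity is for the subspace topology
   and injectivity is restricted to the set. *)
Definition generalized_cantor_set (R : realType) (N : set 'rV[R]_2) : Prop :=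
  exists f : R -> 'rV[R]_2,
    [/\ {within standard_cantor_set R, continuous f},
        set_inj (standard_cantor_set R) f &
        N = f @` standard_cantor_set R].

(* Points of the plane are row vectors, so linear maps act on the right. *)
Definition affine_transformation (R : realType) (h : 'rV[R]_2 -> 'rV[R]_2) :
    Prop :=
  exists (A : 'M[R]_2) (b : 'rV[R]_2),
    A \in unitmx /\ forall x, h x = x *m A + b.

Definition affinely_ambient_homogeneous (R : realType) (N : set 'rV[R]_2) :
    Prop :=
  forall x y, N x -> N y ->
    exists h, [/\ affine_transformation h, h x = y & h @` N = N].

(* Main.v *)
Require Import Defs.
From HB Require Import structures.
From mathcomp Require Import all_boot all_order all_algebra.
From mathcomp Require Import all_classical all_reals all_analysis.
From mathcomp Require Import ring lra.

(* Affine maps of the plane act linearly on the lifts (x, 1).  Let b0 be a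
   point of the Cantor space and choose, for every point b, a symmetry h_b of
   the lifted set N carrying the image of b0 to that of b.  There are
   uncountably many h_b but only countably many clopen subsets of N, so two
   distinct ones, h_b and h_b', agree on prescribed small clopen neighbourhoods
   of finitely many points of N forming a basis of its linear span.  Then all
   the powers of g = h_b h_b'^-1 stay close to the identity on that span.
   Linear groups have no small subgroups: with D_k = g^k - 1 one has
   D_2k = 2 D_k + D_k^2, so |D_2k| >= 3/2 |D_k| as long as D_k is small, and
   boundedness of the powers forces g = 1 on the span.  Hence h_b and h_b' send
   the image of b0 to the same point, contradicting b <> b'. *)

Set Implicit Arguments.
Unset Strict Implicit.
Unset Printing Implicit Defensive.

Import Order.TTheory GRing.Theory Num.Theory.
Import numFieldNormedType.Exports.

Local Open Scope classical_set_scope.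
Local Open Scope ring_scope.

(** * Matrix norms and linear algebra *)

Lemma mx_norm_lerP (R : realType) m n (A : 'M[R]_(m, n)) (c : R) : 0 <= c ->
  (`|A| <= c) <-> (forall i j, `|A i j| <= c).
Proof.
move=> c0; rewrite [`|A|]/Num.Def.normr/= mx_normrE.
split=> [/bigmax_leP[_ Ac] i j|Ac].
  exact: (Ac (i, j)).
by apply/bigmax_leP; split=> // -[i j] _; exact: Ac.
Qed.

(** The norm is the largest absolute value of an entry, and an entry of the product is a sum of [n]
    terms; hence the factor [n]. *)
Lemma ler_mx_normM (R : realType) m n p (A : 'M[R]_(m, n)) (B : 'M[R]_(n, p)) :
  `|A *m B| <= n%:R * `|A| * `|B|.
Proof.
apply/mx_norm_lerP => [|i j]; first by rewrite !mulr_ge0.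
rewrite mxE (le_trans (ler_norm_sum _ _ _))//.
have -> : n%:R * `|A| * `|B| = \sum_(k < n) (`|A| * `|B|).
  by rewrite sumr_const card_ord -mulrA mulr_natl.
apply: ler_sum => k _; rewrite normrM ler_pM//.
  by have /(_ (lexx _)) := (mx_norm_lerP A (normr_ge0 A)).1; exact.
by have /(_ (lexx _)) := (mx_norm_lerP B (normr_ge0 B)).1; exact.
Qed.

Lemma small_powers_eq1 (R : realType) n (Q : 'M[R]_n) (c : R) :
  n%:R * c <= 2^-1 -> (forall k, `|Q ^+ k - 1| <= c) -> Q = 1.
Proof.
move=> nc Qc.
have dbl k : `|Q ^+ k - 1| <= 2 / 3 * `|Q ^+ (k + k) - 1|.
  have [D QD] : exists D, Q ^+ k = 1 + D.
    by exists (Q ^+ k - 1); rewrite addrC subrK.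
  have -> : Q ^+ (k + k) - 1 = D *+ 2 + D *m D.
    rewrite exprD QD mulrDl mulrDr !mulr1 mul1r -[D *m D]/(D * D).
    by rewrite -!addrA addrC !addrA subrK mulrDr mulr1 addrA.
  rewrite QD addrC addKr.
  have := ler_mx_normM D D; have := ler_normB (D *+ 2 + D *m D) (D *m D).
  rewrite addrK normrMn => h1 h2.
  (* The quadratic term costs at most half of [|D|], which leaves 3/2 of the 2 [|D|] coming from the
     linear term. *)
  have h3 : n%:R * `|D| * `|D| <= 2^-1 * `|D|.
    rewrite ler_wpM2r// (le_trans _ nc)// ler_wpM2l//.
    by have := Qc k; rewrite QD addrC addKr.
  lra.
(* Passing from [k] to 2[k] gains a factor 2/3, and the bound [c] is uniform in [k], so the doubling
   can be iterated [j] times. *)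
have small j k : `|Q ^+ k - 1| <= c * (2 / 3) ^+ j.
  elim: j k => [|j IH] k; first by rewrite mulr1.
  by apply: (le_trans (dbl k)); rewrite exprS mulrCA ler_wpM2l.
apply/eqP; rewrite -subr_eq0 -normr_eq0 eq_le normr_ge0 andbT.
have cv : c * (2 / 3) ^+ j @[j --> \oo] --> (0 : R).
  by apply: cvg_geometric; rewrite ger0_norm ?divr_ge0//; lra.
by apply: (cvgr_to_ge cv); near=> j; have := small j 1%N; rewrite expr1.
Unshelve. all: by end_near. Qed.

(** Otherwise every free family in [S] could be enlarged by a vector of [S] outside its span, up to
    [n.+1] independent rows of length [n]. *)
Lemma exists_row_basis (F : fieldType) n (S : set 'rV[F]_n) :
  exists r (P : 'M[F]_(r, n)),
    [/\ row_free P, (forall i, S (row i P)) & (forall x, S x -> (x <= P)%MS)].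
Proof.
apply: contrapT => noP.
have [P /eqP rP _] : exists2 P : matrix F n.+1 n,
    row_free P & (forall i, S (row i P)).
  elim: n.+1 => [|r [P freeP SP]].
    by exists 0 => [|[]//]; rewrite /row_free mxrank0.
  have [x Sx xP] : exists2 x, S x & ~~ (x <= P)%MS.
    apply: contrapT => noX; apply: noP; exists r, P; split=> // x Sx.
    by apply: contrapT => /negP xP; apply: noX; exists x.
  rewrite -addn1; exists (col_mx P x) => [|i].
    apply: inj_row_free => v; rewrite -[v]hsubmxK mul_row_col.
    move: (lsubmx v) (rsubmx v) => u a.
    rewrite [a]mx11_scalar mul_scalar_mx; have [-> | a0] := eqVneq (a 0 0) 0.
      rewrite scale0r addr0 -(mul0mx _ P) => /(row_free_inj freeP) ->.
      by rewrite raddf0 row_mx0.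
    move=> /eqP; rewrite addrC addr_eq0 => /eqP ax; case/negP: xP.
    by rewrite -(eqmx_scale _ a0) ax -mulNmx submxMl.
  rewrite -[i]splitK; case: (fintype.split i) => j /=.
    by rewrite rowKu.
  by rewrite rowKd row_id.
by have := rank_leq_col P; rewrite rP ltnn.
Qed.

Lemma mulmxr_continuous (R : realType) m n p (A : 'M[R]_(n, p)) :
  continuous (fun x : 'M[R]_(m, n) => x *m A).
Proof.
move=> x; apply/(@cvgrPdist_le _ _ _ (nbhs x)) => e e0.
(* Adding 1 keeps the Lipschitz constant positive when [A] is 0, so that one can divide by it. *)
have cA : 0 < n%:R * `|A| + 1 by rewrite ltr_wpDl// mulr_ge0.
near=> y; rewrite -mulmxBl (le_trans (ler_mx_normM _ _))// mulrAC.
apply: (@le_trans _ _ ((n%:R * `|A| + 1) * `|x - y|)).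
  by rewrite ler_wpM2r// lerDl.
rewrite -ler_pdivlMl//; near: y; apply: cvgr_dist_le => //.
by rewrite mulr_gt0// invr_gt0.
Unshelve. all: by end_near. Qed.

(** * Countability and clopen sets *)

(** Cantor's diagonal argument: [d] holds at the code of [j b] exactly when [b] fails there, which
    is contradictory for [b = d]. *)
Lemma nat_bool_not_inj (T : countType) (j : (nat -> bool) -> T) :
  exists b b', b <> b' /\ j b = j b'.
Proof.
apply: contrapT => inj.
have {}inj b b' : j b = j b' -> b = b'.
  by move=> jb; apply: contrapT => bb'; apply: inj; exists b, b'.
pose d n := `[< exists2 b, pickle (j b) = n & ~~ b n >].
case E: (d (pickle (j d))); last first.
  by move/asboolPn: (E); apply; exists d => //; rewrite E.
have /asboolP[b] := E.
by move=> /(pcan_inj pickleK)/inj ->; rewrite E.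
Qed.

(* R only serves to metrize the Cantor space. *)
Lemma countable_clopen_cantor_space (R : realType) :
  countable (@clopen cantor_space).
Proof.
apply: clopen_countable; first exact: cantor_space_compact.
pose T : pseudoPMetricType R := HB.pack cantor_space (Pointed.on cantor_space)
 (PseudoMetric.on (prod_topology (fun _ : nat => bool))).
exact: (@compact_second_countable R T cantor_space_compact).
Qed.

Lemma closed_preimage_image (T U : topologicalType) (f g : T -> U) (A : set T) :
  compact [set: T] -> hausdorff_space U -> continuous f -> continuous g ->
  closed A -> closed (f @^-1` (g @` A)).
Proof.
move=> cT hU cf cg cA; apply: preimage_closed => [x _|]; first exact: cf.
apply: compact_closed => //; apply: continuous_compact.
  exact: continuous_subspaceT.
exact: subclosed_compact cA cT _.
Qed.

(** Since [g] is injective and its range contains that of [f], pulling back images under [g]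
    commutes with complements; openness thus reduces to closedness for the complement of [A]. *)
Lemma clopen_preimage_image (T U : topologicalType) (f g : T -> U) (A : set T) :
  compact [set: T] -> hausdorff_space U -> continuous f -> continuous g ->
  injective g -> range f `<=` range g ->
  clopen A -> clopen (f @^-1` (g @` A)).
Proof.
move=> cT hU cf cg ig fg [oA cA]; split; last exact: closed_preimage_image.
rewrite -[X in open X]setCK; apply: closed_openC.
have -> : ~` (f @^-1` (g @` A)) = f @^-1` (g @` (~` A)).
  apply/seteqP; split=> x /= fx.
    have [|y _ gy] := fg (f x); first by exists x.
    by exists y => // Ay; apply: fx; exists y.
  by case: fx => y nAy gy [z Az gz]; apply: nAy; rewrite (ig y z)// gy gz.
by apply: closed_preimage_image => //; exact: open_closedC.
Qed.

(** * Linear symmetries of an embedded Cantor space *)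

Section homogeneous.
Variables (R : realType) (n : nat) (psi : cantor_space -> 'rV[R]_n).
Hypotheses (psi_cont : continuous psi) (psi_inj : injective psi).

Let stab (H : 'M[R]_n) := (fun x => x *m H) @` range psi = range psi.

Lemma small_clopen_nbhs (b : cantor_space) (e : R) : 0 < e ->
  exists A : set cantor_space,
    [/\ clopen A, A b & forall a, A a -> `|psi b - psi a| <= e].
Proof.
move=> e0; have := zero_dimensional_cvg (x := b) cantor_space_hausdorff
  cantor_zero_dimensional cantor_space_compact.
move=> /(_ (psi @^-1` [set y | `|psi b - y| <= e]))[].
  by apply: psi_cont; apply: (@cvgr_dist_le _ _ _ (nbhs (psi b))).
by move=> A [Ab cA] Ae; exists A; split=> // a /Ae.
Qed.

Lemma small_stabilizer (I : finType) (c : I -> cantor_space)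
    (h : cantor_space -> 'M[R]_n) (e : R) : 0 < e ->
  (forall b, h b \in unitmx) -> (forall b, stab (h b)) ->
  exists b b', b <> b' /\
    forall i k, `|psi (c i) - psi (c i) *m (h b *m invmx (h b')) ^+ k| <= e.
Proof.
move=> e0 hU hS.
have [A Ac] := choice (fun i => small_clopen_nbhs (c i) e0).
pose W b i := psi @^-1` ((fun a => psi a *m h b) @` A i).
have cW b i : clopen (W b i).
  apply: clopen_preimage_image => //.
  - exact: cantor_space_compact.
  - move=> x; apply: (@continuous_comp _ _ _ psi (fun y => y *m h b) x).
      exact: psi_cont.
    exact: (@mulmxr_continuous R 1 n n (h b)).
  - by move=> x y /(can_inj (mulmxK (hU b)))/psi_inj.
  - by rewrite -(hS b) => _ [_ [a _ <-] <-]; exists a.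
  - by have [] := Ac i.
have /countable_injP[code code_inj] := countable_clopen_cantor_space R.
(* As [I] is finite, the families of codes form a countable type. *)
have [b [b' [bb' jb]]] := nat_bool_not_inj (fun b => [ffun i => code (W b i)]).
have WE i : W b i = W b' i.
  by apply: code_inj; rewrite ?inE//; have /ffunP/(_ i) := jb; rewrite !ffunE.
exists b, b'; split=> // i k.
suff [a Aa ->] : exists2 a, A i a &
    psi (c i) *m (h b *m invmx (h b')) ^+ k = psi a.
  by have [_ _] := Ac i; exact.
elim: k => [|k [a Aa IH]].
  by exists (c i); [have [] := Ac i|rewrite expr0 mulmx1].
rewrite exprSr -[_ * _]/(_ *m _) mulmxA IH mulmxA.
have [x _ xE] : range psi (psi a *m h b).
  by rewrite -(hS b); exists (psi a) => //; exists a.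
have : W b i x by exists a.
by rewrite WE => -[a' Aa' a'E]; exists a' => //; rewrite -xE -a'E mulmxK.
Qed.

Lemma not_linearly_homogeneous (b0 : cantor_space) :
  ~ (forall b, exists H, [/\ H \in unitmx, psi b0 *m H = psi b & stab H]).
Proof.
move=> hom; have [h hP] := choice hom.
have hU b : h b \in unitmx by have [] := hP b.
have hS b : stab (h b) by have [] := hP b.
have [r [P [freeP NP spanP]]] := exists_row_basis (range psi).
have [c cP] : exists c : 'I_r -> cantor_space, forall i, psi (c i) = row i P.
  have rowE i : exists b, psi b = row i P by have [b _ bP] := NP i; exists b.
  by have [c cP] := choice rowE; exists c.
(* [K * e] will be the product of the size of [Q] and the bound on its powers minus 1; [e] makes it
   at most 1/2, and the added 1 allows [K = 0]. *)
pose K := r%:R * (n%:R * `|pinvmx P|).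
have K0 : 0 <= K by rewrite !mulr_ge0.
pose e := (2 * (K + 1))^-1.
have e0 : 0 < e by rewrite invr_gt0; lra.
have [b [b' [bb' small]]] := small_stabilizer c e0 hU hS.
set H := h b *m invmx (h b') in small.
(* [Q] is the matrix of [H] on the span of [range psi] in the basis [P]; this span is stable because
   both [h b] and [h b'] preserve [range psi]. *)
pose Q := P *m H *m pinvmx P.
have PH : P *m H = Q *m P.
  rewrite /Q mulmxKpV//; apply/row_subP => i; rewrite row_mul -cP.
  apply: spanP; rewrite mulmxA.
  have [x _ <-] : range psi (psi (c i) *m h b).
    by rewrite -(hS b); exists (psi (c i)) => //; exists (c i).
  have : range psi (psi x) by exists x.
  by rewrite -{1}(hS b') => -[_ [y _ <-] <-]; rewrite mulmxK//; exists y.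
have PHk k : P *m H ^+ k = Q ^+ k *m P.
  elim: k => [|k IH]; first by rewrite !expr0 mulmx1 mul1mx.
  by rewrite !exprSr -![_ * _]/(_ *m _) mulmxA IH -mulmxA PH mulmxA.
have Q1 : Q = 1.
  apply: (@small_powers_eq1 _ _ _ (n%:R * e * `|pinvmx P|)) => [|k].
    rewrite [leLHS](_ : _ = K * e); last by rewrite /K; ring.
    by rewrite /e invfM mulrCA ler_piMr// ler_pdivrMr; lra.
  have -> : Q ^+ k - 1 = (P *m H ^+ k - P) *m pinvmx P.
    by rewrite mulmxBl PHk -mulmxA mulmxVp// mulmx1.
  apply: (le_trans (ler_mx_normM _ _)); rewrite ler_wpM2r// ler_wpM2l//.
  apply/mx_norm_lerP => [|i j]; first exact: ltW.
  have := small i k; rewrite distrC cP -row_mul -linearB/=.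
  by move/(mx_norm_lerP _ (ltW e0)) => /(_ 0 j); rewrite mxE.
apply: bb'; apply: psi_inj.
have [_ <- _] := hP b; have [_ <- _] := hP b'.
apply: (can_inj (mulmxK (_ : invmx (h b') \in unitmx))).
  by rewrite unitmx_inv.
rewrite mulmxK// -mulmxA -/H.
have /submxP[u ->] : (psi b0 <= P)%MS by apply: spanP; exists b0.
by rewrite -mulmxA PH Q1 mul1mx.
Qed.
End homogeneous.

(** * The standard Cantor set as an injective continuous image of the Cantor space *)

Section ternary_expansion.
Variable R : realType.
Implicit Types b : cantor_space.

(* b 0 is the digit of weight 1/3: the sums start at k = 1. *)
Let digit b k : R := (b k.-1)%:R * 2.
Let psum b m n : R := \sum_(m <= k < n) digit b k * 3 ^- k.

Lemma ternary_psumE m n : (m <= n)%N ->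
  \sum_(m <= k < n) 2 * 3 ^- k = 3 * (3 ^- m - 3 ^- n) :> R.
Proof.
move=> mn; rewrite -(subnK mn) addnC; elim: (n - m)%N => [|d IH].
  by rewrite addn0 big_geq// subrr mulr0.
rewrite addnS big_nat_recr ?leq_addr//= IH.
by rewrite exprSr invfM; lra.
Qed.

Let digit_ge0 b k : 0 <= digit b k.
Proof. by rewrite /digit mulr_ge0 ?ler0n. Qed.

Let digit_le2 b k : digit b k <= 2.
Proof. by rewrite /digit; case: (b _); rewrite ?mul1r ?mul0r. Qed.

Let psum_ge0 b m n : 0 <= psum b m n.
Proof. by apply: sumr_ge0 => k _; rewrite mulr_ge0. Qed.

Let psum_le b m n : psum b m n <= 3 * 3 ^- m.
Proof.
have [mn|/ltnW nm] := leqP m n; last by rewrite /psum big_geq ?mulr_ge0.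
apply: (@le_trans _ _ (\sum_(m <= k < n) 2 * 3 ^- k)).
  by apply: ler_sum => k _; rewrite ler_wpM2r.
by rewrite ternary_psumE// ler_wpM2l// lerBlDr lerDl invr_ge0 exprn_ge0.
Qed.

Definition cantor_ternary b : R := lim (psum b 1 n @[n --> \oo]).

Lemma cvg_ternary b : psum b 1 n @[n --> \oo] --> cantor_ternary b.
Proof.
apply: nondecreasing_is_cvgn; last first.
  by exists (3 * 3 ^- 1) => _ [k _ <-]; exact: psum_le.
move=> m n mn; have [m1|m1] := leqP m 1.
  by rewrite [leLHS]big_geq ?psum_ge0.
by rewrite /psum (@big_cat_nat _ _ _ m 1 n)//= ?(ltnW m1)// lerDl psum_ge0.
Qed.

(** The tail from index [m] on is largest when all its digits are 2. Both continuity and injectivity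
    rest on this estimate. *)
Lemma ternary_split b m : (0 < m)%N ->
  psum b 1 m <= cantor_ternary b <= psum b 1 m + 3 * 3 ^- m.
Proof.
move=> m0; apply/andP; split.
  apply: (cvgr_to_ge (@cvg_ternary b)); exists m => // n /= mn.
  by rewrite /psum (@big_cat_nat _ _ _ m 1 n)//= lerDl psum_ge0.
apply: (cvgr_to_le (@cvg_ternary b)); exists m => // n /= mn.
by rewrite /psum (@big_cat_nat _ _ _ m 1 n)//= lerD2l psum_le.
Qed.

Let eq_psum b b' m : (forall k, (k < m)%N -> b k = b' k) ->
  psum b 1 m.+1 = psum b' 1 m.+1.
Proof.
move=> bb'; apply: eq_big_nat => -[|k]//= km.
by rewrite /digit/= bb'.
Qed.

Lemma cantor_ternary_continuous : continuous cantor_ternary.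
Proof.
move=> b; apply/(@cvgrPdist_lt _ _ _ (nbhs b)) => e e0.
have cv : 3 * (3^-1) ^+ j @[j --> \oo] --> (0 : R).
  by apply: cvg_geometric; rewrite ger0_norm; lra.
have [m _ /(_ m (leqnn m))/=] := @cvgr0_norm_lt _ _ _ _ _ _ cv _ e0.
rewrite ger0_norm ?mulr_ge0 ?exprn_ge0// => me.
(* A neighbourhood in the product topology can fix finitely many coordinates; the two values then
   lie in a common interval of length 3^-m. *)
have : \forall b' \near b, forall k, (k < m.+1)%N -> b' k = b k.
  elim: (m.+1) => [|j IH]; first by near=> b'.
  have : \forall b' \near b, b' j = b j.
    have := discrete_set1 (b j).
    exact: (@proj_continuous _ (fun _ : nat => bool) j b).
  move: IH; apply: filterS2 => b' H1 H2 k.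
  by rewrite ltnS leq_eqVlt => /orP[/eqP ->|/H1].
apply: filterS => b' bb'.
have := @ternary_split b m.+1 isT; have := @ternary_split b' m.+1 isT.
rewrite (eq_psum (b := b') (b' := b) (fun k km => bb' k (ltnW km))).
rewrite exprS invfM mulVKf// -exprVn => /andP[? ?] /andP[? ?].
have : 0 <= 3^-1 ^+ m :> R by rewrite exprn_ge0.
move=> ?; rewrite ltr_norml; apply/andP; split; lra.
Unshelve. all: by end_near. Qed.

(** At the first index [m] where the sequences differ, the digits 0 and 2 create a gap of 2 *
    3^-(m+1), while the later digits can make up for at most 3^-(m+1). *)
Lemma cantor_ternary_inj : injective cantor_ternary.
Proof.
suff lt_inj b b' m : (forall k, (k < m)%N -> b k = b' k) -> ~~ b m -> b' m ->
    cantor_ternary b < cantor_ternary b'.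
  move=> b b' E; apply: contrapT => bb'.
  have ex : exists m, b m != b' m.
    apply: contrapT => H; apply: bb'; apply/funext => k.
    by apply/eqP; apply: contrapT => /negP ?; apply: H; exists k.
  case: (ex_minnP ex) => m bm min.
  have eqb k : (k < m)%N -> b k = b' k.
    by move=> km; apply/eqP; apply: contraTT km => /min; rewrite -leqNgt.
  case bmE : (b m); case b'mE : (b' m); move: bm; rewrite bmE b'mE// => _.
    have := @lt_inj b' b m (fun k km => esym (eqb k km)).
    by rewrite E ltxx bmE b'mE => /(_ isT isT).
  by have := @lt_inj b b' m eqb; rewrite E ltxx bmE b'mE => /(_ isT isT).
move=> bb' bm b'm.
have /andP[_ h1] := @ternary_split b m.+2 isT.
have /andP[h2 _] := @ternary_split b' m.+2 isT.
apply: (le_lt_trans h1); apply: (lt_le_trans _ h2).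
rewrite /psum !(@big_nat_recr _ _ _ m.+1)//= -!/(psum _ _ _) (eq_psum bb').
rewrite -addrA ltrD2l /digit/= (negbTE bm) b'm mul0r mul0r add0r mul1r.
by rewrite (exprS _ m.+1) invfM mulVKf// -[ltLHS]mul1r ltr_pM2r ?ltr1n.
Qed.

Lemma standard_cantor_setE : standard_cantor_set R = range cantor_ternary.
Proof.
apply/seteqP; split=> [x [a [a02 ax]]|_ [b _ <-]].
  (* The shift matches sequences indexed from 0 with sums starting at 1. *)
  exists (fun k => a k.+1 == 2) => //.
  apply: (cvg_unique _ (@cvg_ternary _)) => //.
  apply: cvg_trans ax; apply: near_eq_cvg; apply: nearW => n.
  apply: eq_big_nat => -[|k]// _.
  rewrite /digit/=; case: (a02 k.+1) => ->.
    by rewrite lt_eqF ?mul0r// ltr0n.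
  by rewrite eqxx mul1r.
exists (digit b); split; last exact: cvg_ternary.
by move=> k; rewrite /digit; case: (b _); rewrite ?mul0r ?mul1r; [right|left].
Qed.

End ternary_expansion.

(** Composing with the ternary map turns continuity and injectivity relative to a subset of [R] into
    global properties on a compact space. *)
Lemma generalized_cantor_set_range (R : realType) (N : set 'rV[R]_2) :
  generalized_cantor_set N ->
  exists g : cantor_space -> 'rV[R]_2,
    [/\ continuous g, injective g & N = range g].
Proof.
case=> f [cf injf ->]; rewrite standard_cantor_setE in cf injf *.
pose t := @cantor_ternary R.
have tN b : range t (t b) by exists b.
exists (f \o t); split; last by rewrite image_comp.
- move=> b; apply: (@cvg_trans _ (f x @[x --> within (range t) (nbhs (t b))])).
    (* All values of [t] lie in [range t], so the restriction to the subspace holds automatically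
       along [t]. *)
    move=> A fA; have tA := @cantor_ternary_continuous R b _ fA.
    apply: (@filterS _ (nbhs b) _ _ _ _ tA). by move=> b1 /(_ (tN b1)).
  exact: ((subspace_continuousP (range t) f).1 cf (t b) (tN b)).
- move=> b b' /injf bb'; apply: (@cantor_ternary_inj R).
  by apply: bb'; rewrite inE; exact: tN.
Qed.

(** * Affine maps as linear maps on lifted points *)

Definition homogenize (R : realType) n (x : 'rV[R]_n) : 'rV[R]_(n + 1) :=
  row_mx x 1.

Lemma homogenize_inj (R : realType) n : injective (@homogenize R n).
Proof. by move=> x y /eq_row_mx[]. Qed.

Lemma homogenize_continuous (R : realType) n : continuous (@homogenize R n).
Proof.
move=> x; apply/(@cvgrPdist_le _ _ _ (nbhs x)) => e e0; near=> y.
rewrite /homogenize opp_row_mx add_row_mx subrr.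
apply: (@le_trans _ _ `|x - y|); last by near: y; exact: cvgr_dist_le.
apply/mx_norm_lerP => // i j; rewrite mxE.
by case: splitP => k _; [exact: (mx_norm_lerP _ _).1|rewrite mxE normr0].
Unshelve. all: by end_near. Qed.

Lemma affine_homogenize (R : realType) (h : 'rV[R]_2 -> 'rV[R]_2) :
  affine_transformation h -> exists2 H : 'M[R]_(2 + 1), H \in unitmx &
    forall x, homogenize x *m H = homogenize (h x).
Proof.
move=> [A [b [uA hE]]]; exists (block_mx A 0 b 1) => [|x].
  by rewrite unitmxE det_lblock det1 mulr1 -unitmxE.
by rewrite /homogenize mul_row_block !mul1mx mulmx0 add0r hE.
Qed.

Theorem mainTheorem2 (R : realType) (N : set 'rV[R]_2) :
  generalized_cantor_set N -> ~ affinely_ambient_homogeneous N.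
Proof.
move=> /generalized_cantor_set_range[g [g_cont g_inj ->]] hom.
pose psi b := homogenize (g b).
have psi_cont : continuous psi.
  move=> b; apply: (@continuous_comp _ _ _ g (@homogenize R 2)).
    exact: g_cont.
  exact: homogenize_continuous.
have psi_inj : injective psi by move=> b b' /homogenize_inj/g_inj.
apply: (not_linearly_homogeneous psi_cont psi_inj (b0 := point)) => b.
have [|| h [/affine_homogenize[H uH hH] gb hN]] := hom (g point) (g b).
- by exists point.
- by exists b.
exists H; split=> //; first by rewrite hH gb.
(* Lifting intertwines [h] with [H], so the invariance of the planar set under [h] becomes that of
   its lift under [H]. *)
have -> : range psi = @homogenize R 2 @` range g by rewrite image_comp.
rewrite -[in RHS]hN !image_comp.
by congr (_ @` _); apply/funext => c /=; rewrite hH.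
Qed.
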